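(* Let $p>2$ be a prime, let $n\geq 2$ be an integer, let $q$ be a prime divisor of $p-1$, and let $G_{n,p}$ be the non-abelian $P$-group of order $p^{n-1}q$ in the class $P(n,p)$. Then $$csd(G_{n,p})=\frac{\left(2+p+p^2+\dots+p^{n-2}\right)\left(2+p+p^2+\dots+p^{n-1}\right)+p^{n-1}\left(3+p+p^2+\dots+p^{n-2}\right)}{\left(2+p+p^2+\dots+p^{n-1}\right)^2},$$ where $2+p+p^2+\dots+p^{k}$ means $1+\sum_{i=0}^{k}p^i$ and $3+p+p^2+\dots+p^{k}$ means $2+\sum_{i=0}^{k}p^i$ for every integer $k\geq 0$.
   Context: For a finite group $G$, $L_1(G)$ denotes the set of all cyclic subgroups of $G$ (including the trivial subgroup), and the cyclic subgroup commutativity degree of $G$ is $$csd(G)=\frac{1}{|L_1(G)|^2}\left|\{(H,K)\in L_1(G)^2\mid HK=KH\}\right|,$$ where $HK=\{hk\mid h\in H,\,k\in K\}$ and the equality is an equality of sets. The non-abelian group $G_{n,p}$ of order $p^{n-1}q$ in the class $P(n,p)$ is the semidirect product $G_{n,p}=M\langle x\rangle$, where $M\cong\mathbb{Z}_p^{n-1}$ is an elementary abelian normal subgroup of order $p^{n-1}$, $x$ has order $q$ (a prime different from $p$), and $x$ induces a nontrivial power automorphism on $M$: there is an integer $r$ with $r\not\equiv 1 \pmod p$ such that $x^{-1}yx=y^r$ for all $y\in M$. For given $p$, $n$ and prime $q\mid p-1$ this group is unique up to isomorphism. *)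

(* Defs.v *)
From mathcomp Require Import all_boot all_order all_algebra all_fingroup.
From mathcomp Require Import all_solvable.

Set Implicit Arguments.
Unset Strict Implicit.
Unset Printing Implicit Defensive.

Import GRing.Theory Num.Theory.

(* L_1(G); [subgroups G] is the library's set of all subgroups of G. *)
Definition cyclic_subgroups (gT : finGroupType) (G : {group gT}) :
    {set {group gT}} :=
  [set H in subgroups G | cyclic H].

(* [*] in group scope is the product of sets {h * k | h in H, k in K}, so
   the test below is an equality of sets. *)
Definition csd (gT : finGroupType) (G : {group gT}) : rat :=
  (#|[set HK in setX (cyclic_subgroups G) (cyclic_subgroups G)
        | (HK.1 * HK.2)%g == (HK.2 * HK.1)%g]|%:R
   / #|cyclic_subgroups G|%:R ^+ 2)%R.

(* In group scope [y ^ x] is the conjugate x^-1 * y * x, and [M ><| X = G] is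
   the internal semidirect product with normal factor M. The exponent may be
   taken in nat because y ^+ p = 1 for all y in M. *)
Definition nonabelian_P_group (p n q : nat) (gT : finGroupType)
    (G : {group gT}) : Prop :=
  [/\ prime p, prime q, q != p &
    exists (M : {group gT}) (x : gT) (r : nat),
      [/\ (M ><| <[x]>)%g = G,
          (p.-abelem M)%g,
          #|M| = (p ^ n.-1)%N,
          #[x]%g = q &
          r != 1 %[mod p] /\
          (forall y, y \in M -> (y ^ x = y ^+ r)%g)]].

(* Main.v *)
(** In [G = M ><| <[x]>] the element [x] acts on [M] by a nontrivial power
    automorphism, hence without fixed points, and [G] is a Frobenius group.
    A cyclic subgroup not contained in the kernel [M] meets [M] trivially, so
    it is one of the [#|M|] Sylow [q]-subgroups. The cyclic subgroups of [M]
    are normal in [G] and hence permute with everything, whereas two distinct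
    Sylow [q]-subgroups never permute: their product would be a [q]-group
    properly containing a Sylow subgroup. *)

Require Import Defs.
From mathcomp Require Import all_boot all_order all_algebra all_fingroup.
From mathcomp Require Import all_solvable ring.

Set Implicit Arguments.
Unset Strict Implicit.

Import GRing.Theory Num.Theory.

Lemma mem_cyclic_subgroups (gT : finGroupType) (G H : {group gT}) :
  (H \in cyclic_subgroups G) = (H \subset G) && cyclic H.
Proof. by rewrite !inE. Qed.

(** A cyclic subgroup of an elementary abelian [p]-group has order 1 or [p]. The sum counts those of
    order [p]; the successor is the trivial subgroup. *)
Lemma card_cyclic_subgroups_abelem (p : nat) (gT : finGroupType)
    (M : {group gT}) :
  prime p -> (p.-abelem M)%g ->
  #|cyclic_subgroups M| = (\sum_(i < logn p #|M|) p ^ i).+1%N.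
Proof.
move=> p_pr abM.
have <- : #|('E_p^1(M))%g| = \sum_(i < logn p #|M|) p ^ i.
  by apply: (card_p1Elem_pnElem (A := M)); apply/pnElemP.
have -> : cyclic_subgroups M = (1%G |: ('E_p^1(M))%g)%SET.
  apply/setP=> H; rewrite mem_cyclic_subgroups in_setU1.
  apply/andP/orP=> [[sHM cycH] | [/eqP-> | /pnElemP[sHM abH logH]]].
  - have abH := abelemS sHM abM.
    move: cycH; rewrite (abelem_cyclic abH) leq_eqVlt ltnS leqn0.
    case/orP=> [/eqP logH | /eqP logH]; [right | left].
      exact/pnElemP.
    apply/eqP/val_inj/eqP; rewrite /= trivg_card1.
    by rewrite (card_pgroup (abelem_pgroup abH)) logH.
  - by rewrite sub1G cyclic1.
  - by rewrite sHM (abelem_cyclic abH) logH.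
rewrite cardsU1 (_ : 1%G \notin _) //.
by apply/pnElemP=> -[_ _]; rewrite cards1 logn1.
Qed.

(** The abelian group [M] centralises [H], and [x] sends each element of [H] to one of its powers;
    [M] and [x] generate [G]. *)
Lemma normal_power_sdprod (gT : finGroupType) (G M H : {group gT}) (x : gT)
    (r : nat) :
  (M ><| <[x]>)%g = G -> abelian M ->
  (forall y, y \in M -> (y ^ x = y ^+ r)%g) -> H \subset M ->
  (H <| G)%g.
Proof.
move=> /sdprodP[_ <- _ _] abM powx sHM; rewrite /normal; apply/andP; split.
  exact: subset_trans sHM (mulG_subl _ _).
rewrite mul_subG ?cycle_subG //.
  exact: subset_trans (subset_trans abM (centS sHM)) (cent_sub H).
(* Conjugation preserves the order, so one inclusion suffices. *)
apply/normP/eqP; rewrite eqEcard cardJg leqnn andbT.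
apply/subsetP=> _ /imsetP[y Hy ->].
by rewrite powx ?groupX // (subsetP sHM).
Qed.

Lemma power_sdprod_Frobenius (p q r : nat) (gT : finGroupType)
    (G M : {group gT}) (x : gT) :
  prime q -> (M ><| <[x]>)%g = G -> (p.-abelem M)%g -> (M :!=: 1)%g ->
  #[x]%g = q -> r != 1 %[mod p] ->
  (forall y, y \in M -> (y ^ x = y ^+ r)%g) ->
  [Frobenius G = M ><| <[x]>]%g.
Proof.
move=> q_pr defG abM ntM ox r_neq1 powx.
have pr_ox : prime #|<[x]>%g| by rewrite -orderE ox.
apply/Frobenius_semiregularP=> //.
  by rewrite cycle_eq1 -order_eq1 ox; case: (q) q_pr => [|[]].
move=> z /setD1P[ntz Xz]; apply/trivgP/subsetP=> y /setIP[My /cent1P czy].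
rewrite inE; apply: contraR r_neq1 => nty.
(* As [<[x]>] has prime order, the nontrivial [z] generates it. Hence [x] also centralises [y], so
   [y ^+ r = y] with [y] of order [p], which forces [r] to be 1 mod [p]. *)
have sXz : (<[x]> \subset <[z]>)%g.
  apply: (prime_meetG pr_ox).
  by rewrite (setIidPr _) ?cycle_subG // cycle_eq1.
have /cent1P cxy : (x \in 'C[y])%g.
  rewrite -cycle_subG (subset_trans sXz) // cycle_subG.
  by apply/cent1P.
have := powx y My; rewrite conjgE -cxy mulKg => /esym/eqP.
by rewrite -{2}(expg1 y) eq_expg_mod_order (abelem_order_p abM).
Qed.

Section FrobeniusPrimeComplement.

Context (gT : finGroupType) (G M X : {group gT}).
Hypothesis frobG : [Frobenius G = M ><| X]%g.
Hypothesis prX : prime #|X|.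

Let cardG : #|G| = (#|M| * #|X|)%N.
Proof. by have [/sdprod_card] := Frobenius_context frobG. Qed.

Lemma Frobenius_compl_Sylow : (#|X|.-Sylow(G) X)%g.
Proof.
have [defG _ _ _ _] := Frobenius_context frobG.
have coMX := Frobenius_coprime frobG.
have [_ sXG _ _ _] := sdprod_context defG.
rewrite pHallE sXG cardG partnM ?cardG_gt0 //.
rewrite (part_pnat_id (pnat_id prX)) part_p'nat ?mul1n ?eqxx //.
by rewrite p'natE // -prime_coprime // coprime_sym.
Qed.

(** The nontrivial elements of a Frobenius complement form a TI-set: an element of [G] outside [X]
    conjugates them to a disjoint set, so it cannot normalise [X]. *)
Lemma Frobenius_norm_compl : 'N_G(X)%g = X.
Proof.
have [_ _ ntX _ ltXG] := Frobenius_context frobG.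
have /andP[_ /normedTI_P[ntX1 _ tiX]] := FrobeniusWcompl frobG.
apply/eqP; rewrite eqEsubset subsetI (proper_sub ltXG) normG !andbT.
apply/subsetP=> g /setIP[Gg nXg]; apply: tiX => //.
by rewrite conjD1g (normP nXg) -setI_eq0 setIid.
Qed.

Lemma Frobenius_card_Syl_compl : #|('Syl_(#|X|)(G))%g| = #|M|.
Proof.
rewrite (card_Syl Frobenius_compl_Sylow) /= Frobenius_norm_compl.
have [_ _ _ _ ltXG] := Frobenius_context frobG.
by rewrite -divgS ?proper_sub // cardG mulnK ?cardG_gt0.
Qed.

Lemma Frobenius_cyclic_subgroups :
  cyclic_subgroups G = (cyclic_subgroups M :|: 'Syl_(#|X|)(G))%g.
Proof.
have [defG _ _ ltMG _] := Frobenius_context frobG.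
have [nsMG _ _ _ _] := sdprod_context defG.
have /pHallP[_ cardX] := Frobenius_compl_Sylow.
apply/setP=> H; rewrite in_setU !mem_cyclic_subgroups inE pHallE -cardX.
apply/andP/orP=> [[sHG cycH] | [/andP[sHM ->] | /andP[-> /eqP oH]]]; last first.
- by split=> //; rewrite prime_cyclic // oH.
- by rewrite (subset_trans sHM (normal_sub nsMG)).
rewrite sHG cycH /= andbT; case: (boolP (H \subset M)) => sHM; [by left|right].
have tiMH : (M :&: H = 1)%g.
  apply/trivgP/subsetP=> y /setIP[My Hy]; rewrite inE.
  apply: contraR sHM => nty.
  (* The centraliser of a nontrivial kernel element lies in [M], and the abelian group [H]
     centralises [y]. *)
  apply: subset_trans (Frobenius_cent1_ker frobG (x := y) _).
    rewrite subsetI sHG /= -cent_set1 (subset_trans (cyclic_abelian cycH)) //.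
    by rewrite centS // sub1set.
  by rewrite !inE nty.
(* The subgroup [M <*> H] of [G] has order [#|M| * #|H|], which divides [#|M| * #|X|]. *)
have : #|H| %| #|X|.
  rewrite -(@dvdn_pmul2l #|M|) ?cardG_gt0 // -cardG -TI_cardMg //.
  rewrite -norm_joinEr ?(subset_trans sHG (normal_norm nsMG)) //.
  by rewrite cardSg // join_subG normal_sub.
case/primeP: prX => _ /[apply] /orP[|//].
by rewrite -trivg_card1 => /eqP H1; rewrite H1 sub1G in sHM.
Qed.

End FrobeniusPrimeComplement.

Lemma Sylow_commute_eq (q : nat) (gT : finGroupType) (G H K : {group gT}) :
  H \in ('Syl_q(G))%g -> K \in ('Syl_q(G))%g ->
  (H * K == K * H)%g = (H == K).
Proof.
rewrite !inE => sylH sylK; apply/eqP/eqP=> [cHK | -> //].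
have qHK : (q.-group (H <*> K))%g.
  by rewrite comm_joingE // pgroupM (pHall_pgroup sylH) (pHall_pgroup sylK).
have sHKG : (H <*> K \subset G)%g.
  by rewrite join_subG (pHall_sub sylH) (pHall_sub sylK).
have maxHK (L : {group gT}) :
    (q.-Sylow(G) L)%g -> L \subset (H <*> K)%G -> (H <*> K)%G = L.
  by move=> sylL sL; apply/val_inj/(sub_pHall sylL).
by rewrite -(maxHK H) ?joing_subl // {1}(maxHK K) ?joing_subr.
Qed.

(** The pairs are sorted by first component: a member of [A] permutes with all of [L], a Sylow
    subgroup only with [A] and itself. *)
Lemma card_commuting_pairs (q : nat) (gT : finGroupType) (G : {group gT})
    (L A : {set {group gT}}) :
  L = A :|: ('Syl_q(G))%g -> [disjoint A & ('Syl_q(G))%g] ->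
  {in A & L, forall H K : {group gT}, (H * K = K * H :> {set gT})%g} ->
  #|[set HK in setX L L | (HK.1 * HK.2)%g == (HK.2 * HK.1)%g]|
    = (#|A| * (#|A| + #|('Syl_q(G))%g|)
       + #|('Syl_q(G))%g| * (#|A| + 1))%N.
Proof.
set S := ('Syl_q(G))%g => defL disAS cAL.
have cardL : #|L| = (#|A| + #|S|)%N.
  by apply/eqP; rewrite defL (leq_card_setU _ _).
have sAL : A \subset L by rewrite defL subsetUl.
have sSL : S \subset L by rewrite defL subsetUr.
pose perm (H : {group gT}) := [set K in L | (H * K == K * H)%g].
transitivity (\sum_(H in L) #|perm H|).
  under eq_bigr => H _ do rewrite -sum1_card.
  rewrite pair_big_dep -sum1_card; apply: eq_bigl => -[H K] /=.
  by rewrite !inE /= andbA.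
rewrite {1}defL (eq_bigl (fun H => (H \in A) || (H \in S))); last first.
  by move=> H; rewrite in_setU.
rewrite bigU //=; congr (_ + _)%N.
  rewrite -sum_nat_const; apply: eq_bigr => H AH; rewrite -cardL.
  apply/eq_card=> K; rewrite inE.
  by case: (boolP (K \in L)) => //= LK; rewrite cAL ?eqxx.
rewrite -sum_nat_const; apply: eq_bigr => H SH.
have -> : perm H = H |: A.
  apply/setP=> K; rewrite !inE defL in_setU.
  case: (boolP (K \in A)) => [AK | nAK] /=.
    by rewrite orbT (cAL K H) ?eqxx ?(subsetP sSL).
  rewrite orbF; case: (boolP (K \in S)) => [SK | nSK] /=.
    by rewrite (Sylow_commute_eq SH SK) eq_sym.
  by apply/esym/eqP=> eqKH; rewrite eqKH SH in nSK.
by rewrite cardsU1 (disjointFl disAS SH) addnC.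
Qed.

Unset Implicit Arguments.
Set Strict Implicit.
Local Open Scope ring_scope.

Theorem theorem3p1p1 (p n q : nat) (gT : finGroupType) (G : {group gT})
    (p_prime : prime p) (p_gt2 : (2 < p)%N) (n_ge2 : (2 <= n)%N)
    (q_prime : prime q) (q_dvd : (q %| p - 1)%N)
    (GP : nonabelian_P_group p n q G) :
  csd G =
    ((1 + \sum_(i < n.-1) p%:R ^+ i) * (1 + \sum_(i < n) p%:R ^+ i)
       + p%:R ^+ n.-1 * (2%:R + \sum_(i < n.-1) p%:R ^+ i))
    / (1 + \sum_(i < n) p%:R ^+ i) ^+ 2.
Proof.
case: GP => _ _ _ [M [x [r [defG abM cardM ox [r_neq1 powx]]]]].
case: n n_ge2 cardM => [|m] //; rewrite ltnS /= => m_gt0 cardM.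
have ntM : (M :!=: 1)%g.
  by rewrite trivg_card1 cardM -(exp1n m) eqn_exp2r ?gtn_eqF ?prime_gt1.
have frobG := power_sdprod_Frobenius q_prime defG abM ntM ox r_neq1 powx.
have prX : prime #|<[x]>%g| by rewrite -orderE ox.
have defL := Frobenius_cyclic_subgroups frobG prX.
have cardS := Frobenius_card_Syl_compl frobG prX.
(* A Sylow subgroup inside [M] would make [#[x]] divide [#|M|], against coprimality of kernel and
   complement. *)
have disMS : [disjoint cyclic_subgroups M & ('Syl_(#|<[x]>|)(G))%g].
  apply/pred0P=> H /=; apply/negP=> /andP[].
  rewrite mem_cyclic_subgroups inE => /andP[sHM _] sylH.
  have := cardSg sHM; rewrite (card_Hall sylH).
  rewrite -(card_Hall (Frobenius_compl_Sylow frobG prX)) => dvdXM.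
  have := Frobenius_coprime frobG.
  by rewrite coprime_sym prime_coprime // dvdXM.
have cardA : #|cyclic_subgroups M| = (1 + \sum_(i < m) p ^ i)%N.
  by rewrite add1n (card_cyclic_subgroups_abelem p_prime abM) cardM pfactorK.
have cML : {in cyclic_subgroups M & cyclic_subgroups G,
            forall H K : {group gT}, (H * K = K * H :> {set gT})%g}.
  move=> H K; rewrite !mem_cyclic_subgroups => /andP[sHM _] /andP[sKG _].
  have nsHG := normal_power_sdprod defG (abelem_abelian abM) powx sHM.
  by rewrite (normC (subset_trans sKG (normal_norm nsHG))).
(* The [p ^ m] Sylow subgroups supply the last term of the sum. *)
have cardL : #|cyclic_subgroups G| = (1 + \sum_(i < m.+1) p ^ i)%N.
  rewrite defL; apply/eqP.
  have /eqP-> : #|cyclic_subgroups M :|: 'Syl_(#|<[x]>|)(G)|%g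
      == (#|cyclic_subgroups M| + #|'Syl_(#|<[x]>|)(G)|%g)%N.
    by rewrite (leq_card_setU _ _).
  by rewrite cardA cardS cardM big_ord_recr /= addnA.
rewrite /csd (card_commuting_pairs defL disMS cML) cardS cardL cardA cardM.
have sumR k : (\sum_(i < k) p ^ i)%N%:R = \sum_(i < k) p%:R ^+ i :> rat.
  by rewrite natr_sum; apply: eq_bigr => i _; rewrite natrX.
congr (_ / _); last by rewrite natrD sumR.
rewrite big_ord_recr /= -!sumR -natrX.
(* With [1 + a] cyclic subgroups in [M] and [b] Sylow subgroups, the numerators agree as polynomials
   in [a] and [b]. *)
move: (\sum_(i < m) _)%N (p ^ m)%N => a b.
rewrite !(natrD, natrM); ring.
Qed.
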